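(* On HDAs over $\Sigma$, ureST-bisimilarity is strictly contained in reST-bisimilarity: ${\underline{\leftrightarrow}_{ureST}}\subsetneq{\underline{\leftrightarrow}_{reST}}$.
   Context: HDAs. $\Sigma$ is a fixed set of actions, containing pairwise distinct actions $a,b,c,d$. A conclist is $U=(n,\lambda)$ with $n\in\mathbb N$ and $\lambda:\{1<\dots<n\}\to\Sigma$. The category $\square$ has conclists as objects; a morphism $(m,\lambda)\to(n,\mu)$ is a pair $(f,\varepsilon)$ with $f:\{1,\dots,m\}\to\{1,\dots,n\}$ injective, order- and label-preserving, and $\varepsilon:\{1,\dots,n\}\to\{0,*,1\}$ with $\varepsilon^{-1}( * )=\mathrm{im} f$; composition is $(g,\zeta)\circ(f,\varepsilon)=(g\circ f,\eta)$ with $\eta(g(t))=\varepsilon(t)$ and $\eta(u)=\zeta(u)$ for $u\notin\mathrm{im}\,g$. For $1\le i\le n$, $k\in\{0,1\}$, the coface map $d_i^k:U\to V$ ($V$ of dimension $n$, $U$ of dimension $n-1$) has $f$ omitting position $i$, $\varepsilon(i)=k$, and $\varepsilon(j)=*$ for $j\ne i$. A precubical set is a functor $X:\square^{op}\to\mathbf{Set}$; elements of $X[U]$, $U=(n,\lambda)$, are $n$-dimensional cells, and $\delta_i^k:=X[d_i^k]$. An HDA is a pair $(X,i)$ of a precubical set and an initial $0$-dimensional cell $i$. Paths. A path of an HDA $\mathcal X$ is a sequence $\alpha=(x_0,\varphi_1,x_1,\dots,\varphi_n,x_n)$ ($n\ge 0$) with $x_0$ the initial cell, $x_j\in X[U_j]$,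 where for each $j$ either $\varphi_j=d^0_{i_j}:U_{j-1}\to U_j$ with $x_{j-1}=\delta^0_{i_j}(x_j)$ (up-step, starting an event) or $\varphi_j=d^1_{i_j}:U_j\to U_{j-1}$ with $x_j=\delta^1_{i_j}(x_{j-1})$ (down-step, ending an event). $\alpha\hookrightarrow\alpha'$ means $\alpha$ is a prefix of $\alpha'$. $\alpha\leftrightarrows^\ell\beta$ ($\ell$-similarity): one of $\alpha,\beta$ is obtained from the other by replacing, around the cell $x_\ell$, $(d_i^0,x_\ell,d_j^0)$ by $(d_{j-1}^0,x'_\ell,d_i^0)$, or $(d_j^1,x_\ell,d_i^1)$ by $(d_i^1,x'_\ell,d_{j-1}^1)$, for some $i<j$ and some cell $x'_\ell$. $\alpha\sqsubseteq^\ell\beta$ ($\beta$ subsumes $\alpha$ at $\ell$): $\alpha$ is obtained from $\beta$ by replacing, around $x_\ell$, $(d_i^0,x_\ell,d_j^1)$ by $(d_{j-1}^1,x'_\ell,d_i^0)$, or $(d_j^0,x_\ell,d_i^1)$ by $(d_i^1,x'_\ell,d_{j-1}^0)$, for some $i<j$. ST-traces. Given a down-step at position $p$ of a path, move it to the left: as long as the step directly before it is a down-step, or an up-step whose index differs from the current index of the moving down-step, there is a unique replacement moving it one position left: for some $i<j$ and cells $x,x'$, it replaces $(d_j^1,x,d_i^1)$ by $(d_i^1,x',d_{j-1}^1)$ or conversely (if the step directly before is a down-step), or it replaces $(d_i^0,x,d_j^1)$ by $(d_{j-1}^1,x',d_i^0)$ or $(d_j^0,x,d_i^1)$ by $(d_i^1,x',d_{j-1}^0)$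 (if the step directly before is an up-step). This stops when the step directly before it, at position $k$, is an up-step with the same index; put $\mathrm{start}(p)=k$. $\mathsf{ST}(\alpha)$ is the sequence whose $j$-th entry is $a^+$ if $\varphi_j$ is an up-step starting an event labelled $a$ (the label of the $i_j$-th event of $U_j$), and $a^{\mathrm{start}(j)}$ if $\varphi_j$ is a down-step ending an event labelled $a$ (the label of the $i_j$-th event of $U_{j-1}$). $I$-bisimulations. For $I\subseteq\{\sqsubseteq,\sqsupseteq,\leftrightarrows,\hookleftarrow\}$, an $I$-bisimulation between HDAs $\mathcal Y,\mathcal Z$ is a relation $\mathfrak R$ between paths of $\mathcal Y$ and of $\mathcal Z$ satisfying the following clauses, each also with the roles of $\mathcal Y$ and $\mathcal Z$ exchanged: (1) the length-$0$ paths of $\mathcal Y$ and $\mathcal Z$ are related; (2) if $(\alpha,\beta)\in\mathfrak R$ then $\mathsf{ST}(\alpha)=\mathsf{ST}(\beta)$; (3) if $(\alpha,\beta)\in\mathfrak R$ and $\alpha\hookrightarrow\alpha'$, there is $\beta'$ with $\beta\hookrightarrow\beta'$ and $(\alpha',\beta')\in\mathfrak R$; and those of the following whose symbol lies in $I$: ($\sqsubseteq$) if $(\alpha,\beta)\in\mathfrak R$ and $\alpha\sqsubseteq^\ell\alpha'$, there is $\beta'$ with $\beta\sqsubseteq^\ell\beta'$, $(\alpha',\beta')\in\mathfrak R$; ($\sqsupseteq$) the same with $\alpha'\sqsubseteq^\ell\alpha$ and $\beta'\sqsubseteq^\ell\beta$; ($\leftrightarrows$) the same with $\alpha'\leftrightarrows^\ell\alpha$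 and $\beta'\leftrightarrows^\ell\beta$; ($\hookleftarrow$) the same with $\alpha'\hookrightarrow\alpha$ and $\beta'\hookrightarrow\beta$. $\mathcal Y,\mathcal Z$ are $I$-bisimilar, $\mathcal Y\,\underline{\leftrightarrow}_I\,\mathcal Z$, if an $I$-bisimulation between them exists. Names: reST is $I=\{\leftrightarrows,\hookleftarrow\}$; ureST is $I=\{\sqsupseteq,\leftrightarrows,\hookleftarrow\}$. *)

(* Defs.v *)
From mathcomp Require Import all_boot.
From mathcomp Require Import zify.
From Stdlib Require Import FunctionalExtensionality ProofIrrelevance.

Set Implicit Arguments.
Unset Strict Implicit.
Unset Printing Implicit Defensive.

Record conclist (Sigma : Type) := Conclist {
  cdim : nat;
  clab : 'I_cdim -> Sigma }.

(* [heps] takes values in {0, *, 1}: [Some false] is 0, [None] is *, and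
   [Some true] is 1. *)
Record hom (Sigma : Type) (U V : conclist Sigma) := Hom {
  hf : 'I_(cdim U) -> 'I_(cdim V);
  heps : 'I_(cdim V) -> option bool;
  hf_inj : injective hf;
  hf_mono : {homo hf : s t / s <= t};
  hf_lab : forall s, clab (hf s) = clab s;
  heps_im : forall t, heps t = None <-> exists s, hf s = t }.

Section Box.
Variable Sigma : Type.
Implicit Types U V W : conclist Sigma.

Definition hid U : hom U U.
Proof.
by refine (@Hom _ U U id (fun _ => None) _ _ _ _) => // t; split=> // _; exists t.
Defined.

Definition comp_eps U V W (g : hom V W) (f : hom U V) (u : 'I_(cdim W)) :=
  if [pick t | hf g t == u] is Some t then heps f t else heps g u.

Lemma comp_eps_im U V W (g : hom V W) (f : hom U V) t :
  comp_eps g f (hf g t) = heps f t.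
Proof.
rewrite /comp_eps; case: pickP => [t' /eqP /hf_inj -> //|/(_ t)].
by rewrite eqxx.
Qed.

Lemma comp_eps_nim U V W (g : hom V W) (f : hom U V) u :
  (forall t, hf g t <> u) -> comp_eps g f u = heps g u.
Proof. by move=> nim; rewrite /comp_eps; case: pickP => // t /eqP /nim. Qed.

Definition hcomp U V W (g : hom V W) (f : hom U V) : hom U W.
Proof.
refine (@Hom _ U W (fun s => hf g (hf f s)) (comp_eps g f) _ _ _ _).
- by move=> s t /hf_inj /hf_inj.
- by move=> s t le_st; apply/hf_mono/hf_mono.
- by move=> s; rewrite !hf_lab.
move=> u; case: (pickP (fun t => hf g t == u)) => [t /eqP <-|nim].
  rewrite comp_eps_im; split=> [/heps_im [s <-]|[s /hf_inj <-]]; first by exists s.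
  by apply/heps_im; exists s.
have nim' t : hf g t <> u by move/eqP; rewrite nim.
rewrite comp_eps_nim //; split=> [/heps_im [t /nim' //]|[s /nim' //]].
Defined.

(* Positions in a conclist are numbered from 0, not from 1. *)

Definition face_conclist V (i : 'I_(cdim V)) : conclist Sigma :=
  @Conclist Sigma (cdim V).-1 (fun s => clab (lift i s)).

Definition coface (k : bool) V (i : 'I_(cdim V)) : hom (face_conclist i) V.
Proof.
refine (@Hom _ (face_conclist i) V (lift i)
          (fun j => if j == i then Some k else None) _ _ _ _) => //.
- exact: lift_inj.
- by move=> s t le_st; rewrite /= leq_bump2.
move=> t; case: (unliftP i t) => [s ->|->]; last first.
  by rewrite eqxx; split=> // -[s] /eqP; rewrite eq_sym (negbTE (neq_lift _ _)).
by rewrite eq_sym (negbTE (neq_lift _ _)); split=> // _; exists s.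
Defined.

Record precubical := Precubical {
  pob :> conclist Sigma -> Type;
  pmap : forall U V, hom U V -> pob V -> pob U;
  pmap_id : forall U (x : pob U), pmap (hid U) x = x;
  pmap_comp : forall U V W (g : hom V W) (f : hom U V) (x : pob W),
    pmap (hcomp g f) x = pmap f (pmap g x) }.

Definition cell (X : precubical) := {U : conclist Sigma & X U}.

Definition dim (X : precubical) (x : cell X) : nat := cdim (tag x).

Definition face (k : bool) (X : precubical) (x : cell X) (i : 'I_(dim x)) : cell X :=
  existT (fun U => X U) (face_conclist i) (pmap (coface k i) (tagged x)).

(* y = delta_i^k (x), with i given as a natural number *)
Definition is_face (k : bool) (X : precubical) (x : cell X) (i : nat) (y : cell X) :=
  exists lt_i : i < dim x, y = face k (Ordinal lt_i).

Definition has_label (X : precubical) (x : cell X) (i : nat) (l : Sigma) :=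
  exists lt_i : i < dim x, clab (Ordinal lt_i : 'I_(cdim (tag x))) = l.

Record HDA := MkHDA {
  hda_set :> precubical;
  hda_init : cell hda_set;
  hda_init_dim : dim hda_init = 0 }.

(* [D0 i] and [D1 i] stand for the coface maps d_i^0 (an up-step) and d_i^1 (a
   down-step).  The index and the cells before and after the step determine the
   objects between which the map goes. *)
Inductive dmap := D0 of nat | D1 of nat.

Definition step_ok (X : precubical) (x : cell X) (phi : dmap) (y : cell X) : Prop :=
  match phi with
  | D0 i => is_face false y i x
  | D1 i => is_face true x i y
  end.

Fixpoint steps_ok (X : precubical) (x : cell X) (s : seq (dmap * cell X)) : Prop :=
  if s is (phi, y) :: s' then step_ok x phi y /\ steps_ok y s' else True.

(* The path (x_0, phi_1, x_1, ..., phi_n, x_n) is stored as the sequence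
   (phi_1, x_1), ..., (phi_n, x_n); x_0 is always the initial cell. *)
Record hpath (X : HDA) := Path {
  psteps : seq (dmap * cell X);
  psteps_ok : steps_ok (hda_init X) psteps }.

Definition path0 (X : HDA) : hpath X := @Path X [::] I.

(* x_j, for j <= n *)
Definition cell_at (X : HDA) (al : hpath X) (j : nat) : cell X :=
  nth (hda_init X) (hda_init X :: unzip2 (psteps al)) j.

(* phi_j, for 1 <= j <= n *)
Definition dmap_at (X : HDA) (al : hpath X) (j : nat) : option dmap :=
  if j is j'.+1 then onth (unzip1 (psteps al)) j' else None.

Definition prefix_path (X : HDA) (al al' : hpath X) : Prop :=
  exists s, psteps al' = psteps al ++ s.

(* [T p q p' q'] allows replacing (p, x_l, q) by (p', x', q'); [replaced T l al be]
   says that be is obtained from al by such a replacement around x_l. *)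
Definition replaced (T : dmap -> dmap -> dmap -> dmap -> Prop) (X : HDA)
    (l : nat) (al be : hpath X) : Prop :=
  exists p q p' q' x x' y s1 s2,
    [/\ T p q p' q', l = (size s1).+1,
        psteps al = s1 ++ [:: (p, x), (q, y) & s2] &
        psteps be = s1 ++ [:: (p', x'), (q', y) & s2]].

Inductive swap_up : dmap -> dmap -> dmap -> dmap -> Prop :=
| SwapUp i j of i < j : swap_up (D0 i) (D0 j) (D0 j.-1) (D0 i).

Inductive swap_down : dmap -> dmap -> dmap -> dmap -> Prop :=
| SwapDown i j of i < j : swap_down (D1 j) (D1 i) (D1 i) (D1 j.-1).

Inductive swap_sub : dmap -> dmap -> dmap -> dmap -> Prop :=
| SwapSub1 i j of i < j : swap_sub (D0 i) (D1 j) (D1 j.-1) (D0 i)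
| SwapSub2 i j of i < j : swap_sub (D0 j) (D1 i) (D1 i) (D0 j.-1).

Definition similar (X : HDA) (l : nat) (al be : hpath X) : Prop :=
  [\/ replaced swap_up l al be, replaced swap_up l be al,
      replaced swap_down l al be | replaced swap_down l be al].

(* be subsumes al at l *)
Definition subsumed (X : HDA) (l : nat) (al be : hpath X) : Prop :=
  replaced swap_sub l be al.

(* al' arises from al by moving the down-step at position l + 1 to position l. *)
Definition move_left (X : HDA) (l : nat) (al al' : hpath X) : Prop :=
  [\/ replaced swap_down l al al', replaced swap_down l al' al
    | replaced swap_sub l al al'].

(* [start al p k]: start(p) = k for the down-step at position p of al. *)
Inductive start (X : HDA) : hpath X -> nat -> nat -> Prop :=
| StartStop al k i of dmap_at al k = Some (D0 i) & dmap_at al k.+1 = Some (D1 i) :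
    start al k.+1 k
| StartMove al al' p k of move_left p al al' & start al' p k :
    start al p.+1 k.

(* [STplus l] is l^+ and [STend l k] is l^k. *)
Inductive st_event := STplus of Sigma | STend of Sigma & nat.

Inductive ST_entry (X : HDA) (al : hpath X) (j : nat) : st_event -> Prop :=
| EntryUp i l of dmap_at al j = Some (D0 i) & has_label (cell_at al j) i l :
    ST_entry al j (STplus l)
| EntryDown i l k of dmap_at al j = Some (D1 i) & has_label (cell_at al j.-1) i l
    & start al j k :
    ST_entry al j (STend l k).

(* [ST al t]: the ST-trace of al is t.  By [ST_total] and [ST_functional] below,
   every path has exactly one ST-trace, so [same_ST] is ST(al) = ST(be). *)
Definition ST (X : HDA) (al : hpath X) (t : seq st_event) : Prop :=
  size t = size (psteps al) /\
  forall j e, onth t j = Some e -> ST_entry al j.+1 e.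

Lemma eq_pmap (X : precubical) (U : conclist Sigma) n (l l' : 'I_n -> Sigma)
    (f : hom (Conclist l) U) (g : hom (Conclist l') U) (x : X U) :
  hf f =1 hf g -> heps f =1 heps g ->
  existT (fun U => X U) (Conclist l) (pmap f x) =
  existT (fun U => X U) (Conclist l') (pmap g x).
Proof.
move=> eqf eqe.
have el : l = l'.
  apply: functional_extensionality => s.
  exact: etrans (esym (hf_lab f s)) (etrans (congr1 _ (eqf s)) (hf_lab g s)).
case: l' / el g eqf eqe => g eqf eqe; congr existT; congr pmap.
case: f g eqf eqe => [f e f1 f2 f3 f4] [f' e' f1' f2' f3' f4'] /= eqf eqe.
move: (functional_extensionality _ _ eqf) (functional_extensionality _ _ eqe).
move=> ? ?; subst f' e'.
by congr Hom; apply: proof_irrelevance.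
Qed.

Lemma is_face_fun k (X : precubical) (x : cell X) i y y' :
  is_face k x i y -> is_face k x i y' -> y = y'.
Proof. by move=> [lt_i ->] [lt_i' ->]; congr face; apply: val_inj. Qed.

Lemma coface_eps_comp k k' (V : conclist Sigma) (i : 'I_(cdim V))
    (j : 'I_(cdim (face_conclist i))) t :
  heps (hcomp (coface k i) (coface k' j)) t =
  if t == i then Some k else if t == lift i j then Some k' else None.
Proof.
rewrite /=; case: (unliftP i t) => [s ->|->].
  rewrite (@comp_eps_im _ _ _ (coface k i) (coface k' j) s) /=.
  have -> : (lift i s == i) = false by rewrite eq_sym; apply/negbTE/neq_lift.
  by rewrite (inj_eq lift_inj).
rewrite eqxx comp_eps_nim /= ?eqxx // => s /eqP.
by rewrite eq_sym (negbTE (neq_lift _ _)).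
Qed.

Lemma face_face k k' (X : precubical) (x : cell X)
    (j : 'I_(dim x)) (i : 'I_(dim x).-1) (i' : 'I_(dim x)) (j' : 'I_(dim x).-1) :
  i < j -> i' = i :> nat -> j' = j.-1 :> nat ->
  @face k X (face k' j) i = @face k' X (face k i') j'.
Proof.
have nb m n p : m < n -> bump n (bump m p) = bump m (bump n.-1 p).
  by rewrite /bump; lia.
move=> lt_ij ei ej.
have bij : i' = lift j i by apply: val_inj; rewrite /= /bump; lia.
have bji : j = lift i' j' by apply: val_inj; rewrite /= /bump; lia.
rewrite /face /= -!pmap_comp; apply: eq_pmap => [s|t].
  by apply: val_inj; rewrite /= ei ej; apply: nb.
have -> := @coface_eps_comp k' k (tag x) j i t.
have -> := @coface_eps_comp k k' (tag x) i' j' t.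
rewrite -bij -bji; case: eqP => [->|//]; case: eqP => // e.
by move: lt_ij; rewrite e ei ltnn.
Qed.

Lemma is_face_swap k k' (X : precubical) (x : cell X) i j y z : i < j ->
  is_face k' x j y -> is_face k y i z ->
  exists2 y', is_face k x i y' & is_face k' y' j.-1 z.
Proof.
move=> lt_ij [lt_j ->] [lt_i ->].
have lt_i' : i < dim x by exact: ltn_trans lt_ij lt_j.
have lt_j' : j.-1 < (dim x).-1 by lia.
exists (face k (Ordinal lt_i')); first by exists lt_i'.
by exists lt_j'; apply: face_face.
Qed.

Lemma is_face_swapV k k' (X : precubical) (x : cell X) i j y' z : i < j ->
  is_face k x i y' -> is_face k' y' j.-1 z ->
  exists2 y, is_face k' x j y & is_face k y i z.
Proof.
move=> lt_ij [lt_i ->] [lt_j ->].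
have lt_j' : j < dim x by move: lt_j; rewrite /dim /= -/(dim x); lia.
have lt_i' : i < (dim x).-1 by lia.
exists (face k' (Ordinal lt_j')); first by exists lt_j'.
by exists lt_i'; apply/esym/face_face.
Qed.

Lemma steps_ok_cat (X : precubical) (x : cell X) s1 s2 :
  steps_ok x (s1 ++ s2) <-> steps_ok x s1 /\ steps_ok (last x (unzip2 s1)) s2.
Proof.
elim: s1 x => [|[m y] s1 IH] x /=; first by split=> [|[]].
by rewrite IH; split=> [[? [? ?]]|[[? ?] ?]].
Qed.

Lemma psteps_inj (X : HDA) (al be : hpath X) : psteps al = psteps be -> al = be.
Proof.
case: al be => [s ok] [s' ok'] /= e; subst s'.
by congr Path; apply: proof_irrelevance.
Qed.

Lemma split2 T (s : seq T) k u v : onth s k = Some u -> onth s k.+1 = Some v ->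
  exists2 s1, size s1 = k & exists s2, s = s1 ++ [:: u, v & s2].
Proof.
elim: k s => [|k IH] [|w s] //=.
  by case: s => [|w' s] //= [->] [->]; exists [::] => //; exists s.
by move=> /IH{IH}/[apply] -[s1 <- [s2 ->]]; exists (w :: s1) => //; exists s2.
Qed.

Lemma dmap_atP (X : HDA) (al : hpath X) j phi : dmap_at al j.+1 = Some phi ->
  exists x, onth (psteps al) j = Some (phi, x).
Proof.
rewrite /dmap_at; elim: (psteps al) j => [|[m y] s IH] [|j] //=; last exact: IH.
by case=> ->; exists y.
Qed.

Lemma onth_catl T (s1 s2 : seq T) : onth (s1 ++ s2) (size s1) = onth s2 0.
Proof. by elim: s1. Qed.

Lemma dmap_at_mid (X : HDA) (al : hpath X) s1 m x s2 :
  psteps al = s1 ++ (m, x) :: s2 -> dmap_at al (size s1).+1 = Some m.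
Proof. by rewrite /dmap_at => ->; rewrite /unzip1 map_cat -(size_map fst) onth_catl. Qed.

Lemma dmap_at_mid2 (X : HDA) (al : hpath X) s1 m x m' x' s2 :
  psteps al = s1 ++ [:: (m, x), (m', x') & s2] ->
  dmap_at al (size s1).+2 = Some m'.
Proof.
move=> e; have := @dmap_at_mid X al (rcons s1 (m, x)) m' x' s2.
by rewrite size_rcons cat_rcons => ->.
Qed.

Lemma move_left_ex (X : HDA) (al : hpath X) l i m :
  dmap_at al l.+1 = Some m -> dmap_at al l.+2 = Some (D1 i) -> m <> D0 i ->
  exists2 al', move_left l.+1 al al' & exists i', dmap_at al' l.+1 = Some (D1 i').
Proof.
move=> /dmap_atP [x ex] /dmap_atP [y ey] ne.
have [s1 sz [s2 es]] := split2 ex ey.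
have ok := psteps_ok al; rewrite es steps_ok_cat /= in ok.
have [ok1 [ox [oy ok2]]] := ok.
set w := last _ _ in ox.
have mk p x' q : step_ok w p x' -> step_ok x' q y ->
    exists al', psteps al' = s1 ++ [:: (p, x'), (q, y) & s2].
  move=> o1 o2.
  have ok' : steps_ok (hda_init X) (s1 ++ [:: (p, x'), (q, y) & s2]).
    by rewrite steps_ok_cat.
  by exists (Path ok').
case: m ex ne es ox {ok} => j ex ne es /= ox.
- case: (ltngtP j i) => [lt_ji|lt_ij|eji]; last by rewrite eji in ne.
  + have lt_j : j < dim y.
      by case: oy => lt_i ->; rewrite /dim /= -/(dim x); lia.
    have [w' fw f1] := is_face_swap lt_ji oy (ex_intro _ lt_j erefl : is_face false y j _).
    rewrite (is_face_fun fw ox) in f1.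
    have [al' e'] := mk (D1 i.-1) _ (D0 j) f1 (ex_intro _ lt_j erefl).
    exists al'; last by exists i.-1; rewrite -sz; apply: dmap_at_mid e'.
    apply: Or33; do 8 eexists; exists s2; split; [exact: SwapSub1 lt_ji| | exact: es | exact: e'].
    by rewrite sz.
  + have lt_i : i < dim w.
      by case: ox => lt_j ->; rewrite /dim /= -/(dim x); lia.
    have [y' fy f1] := is_face_swap lt_ij ox (ex_intro _ lt_i erefl : is_face true w i _).
    rewrite (is_face_fun fy oy) in f1.
    have [al' e'] := mk (D1 i) _ (D0 j.-1) (ex_intro _ lt_i erefl) f1.
    exists al'; last by exists i; rewrite -sz; apply: dmap_at_mid e'.
    apply: Or33; do 8 eexists; exists s2; split; [exact: SwapSub2 lt_ij| | exact: es | exact: e'].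
    by rewrite sz.
- case: (ltnP i j) => [lt_ij|le_ji].
  + have [x' f1 f2] := is_face_swap lt_ij ox oy.
    have [al' e'] := mk (D1 i) _ (D1 j.-1) f1 f2.
    exists al'; last by exists i; rewrite -sz; apply: dmap_at_mid e'.
    apply: Or31; do 8 eexists; exists s2; split; [exact: SwapDown lt_ij| | exact: es | exact: e'].
    by rewrite sz.
  + have lt_ji : j < i.+1 by [].
    have [x' f1 f2] := is_face_swapV lt_ji ox oy.
    have [al' e'] := mk (D1 i.+1) _ (D1 j) f1 f2.
    exists al'; last by exists i.+1; rewrite -sz; apply: dmap_at_mid e'.
    apply: Or32; do 8 eexists; exists s2; split; [exact: SwapDown lt_ji| | exact: e' | exact: es].
    by rewrite sz.
Qed.

Lemma start_ex (X : HDA) (al : hpath X) p i :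
  dmap_at al p = Some (D1 i) -> exists k, start al p k.
Proof.
case: p => [//|p]; elim: p al i => [|p IH] al i e.
  have [x] := dmap_atP e; have := psteps_ok al.
  case: (psteps al) => [//|[m y] s] /= [ok _] [e1 e2]; subst m y.
  by case: ok => lt_i; exfalso; move: lt_i; rewrite hda_init_dim.
have [m em] : exists m, dmap_at al p.+1 = Some m.
  have [x] := dmap_atP e; rewrite /dmap_at.
  elim: (psteps al) p {IH e} => [//|[m y] s IHs] [|p] //=; first by exists m.
  exact: IHs.
have move_it : m <> D0 i -> exists k, start al p.+2 k.
  move=> ne; have [al' mv [i' /IH [k st]]] := move_left_ex em e ne.
  by exists k; apply: StartMove mv st.
case: m em move_it => [j|j] em move_it; last exact: move_it.
case: (eqVneq j i) => [eji|ne]; last by apply: move_it => -[/eqP]; apply/negP.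
by exists p.+1; apply: (@StartStop _ al p.+1 i); rewrite // em eji.
Qed.

Fixpoint start_of (s : seq dmap) (i : nat) : nat :=
  match s with
  | [::] => 0
  | D0 j :: s' => if j == i then size s else start_of s' (if j < i then i.-1 else i)
  | D1 j :: s' => start_of s' (if i < j then i else i.+1)
  end.

Lemma startE (X : HDA) (al : hpath X) p k : start al p k ->
  exists2 i, dmap_at al p = Some (D1 i) &
    k = start_of (rev (take p.-1 (unzip1 (psteps al)))) i.
Proof.
elim=> {al p k} [al [//|k] i e0 e1|al al' p k mv _ [i e ->]].
  exists i => //; rewrite /= in e0.
  have lt_k : k < size (unzip1 (psteps al)).
    by rewrite ltnNge; apply/negP => /onth_default; rewrite e0.
  rewrite /= (take_nth (D0 0)) // rev_rcons.
  have -> : nth (D0 0) (unzip1 (psteps al)) k = D0 i.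
    exact: onth_nth e0.
  by rewrite /= eqxx size_rev size_takel // ltnW.
case: mv => -[m [q [m' [q' [x [x' [y [s1 [s2 [sw ep ea ea']]]]]]]]]]; subst p;
  rewrite -!pred_Sn in e *;
  have tk (s : seq (dmap * cell X)) u v w : s = s1 ++ [:: u, v & w] ->
    (rev (take (size s1) (unzip1 s)) = rev (unzip1 s1))
    * (rev (take (size s1).+1 (unzip1 s)) = u.1 :: rev (unzip1 s1)) by
    [move=> ->; rewrite /unzip1 map_cat -(size_map fst) take_size_cat //
       -addn1 takeD take_size_cat // drop_size_cat //= ?take0 cats1 rev_rcons].
- rewrite (tk _ _ _ _ ea') (tk _ _ _ _ ea) (dmap_at_mid2 ea).
  case: sw ea ea' => i0 j lt_ij ea ea'; rewrite (dmap_at_mid ea') in e.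
  by exists i0 => //=; rewrite lt_ij; case: e => ->.
- rewrite (tk _ _ _ _ ea) (tk _ _ _ _ ea') (dmap_at_mid2 ea').
  case: sw ea ea' => i0 j lt_ij ea ea'; rewrite (dmap_at_mid ea) in e.
  exists j.-1 => //=; case: e => <-.
  have -> : (j.-1 < i0) = false by lia.
  by rewrite prednK //; lia.
rewrite (tk _ _ _ _ ea') (tk _ _ _ _ ea) (dmap_at_mid2 ea).
case: sw ea ea' => i0 j lt_ij ea ea'; rewrite (dmap_at_mid ea') in e; case: e => <-.
  by exists j => //=; rewrite lt_ij (ltn_eqF lt_ij).
by exists i0 => //=; rewrite (gtn_eqF lt_ij) ltnNge (ltnW lt_ij).
Qed.

Lemma start_fun (X : HDA) (al : hpath X) p k k' :
  start al p k -> start al p k' -> k = k'.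
Proof. by move=> /startE [i e ->] /startE [i' e' ->]; move: e'; rewrite e => -[->]. Qed.

Lemma has_label_fun (X : precubical) (x : cell X) i l l' :
  has_label x i l -> has_label x i l' -> l = l'.
Proof. by move=> [lt_i <-] [lt_i' <-]; congr clab; apply: val_inj. Qed.

Lemma step_at (X : HDA) (al : hpath X) j phi : dmap_at al j.+1 = Some phi ->
  step_ok (cell_at al j) phi (cell_at al j.+1).
Proof.
move=> /dmap_atP [x]; rewrite /cell_at; have := psteps_ok al.
have : forall w z s k, steps_ok z s -> onth s k = Some (phi, x) ->
    step_ok (nth w (z :: unzip2 s) k) phi (nth w (z :: unzip2 s) k.+1).
  move=> w z s; elim: s z => [z k|[m y] s IH z [|k] /= [oz os]]; [by rewrite onth0n | by case=> <- _ |].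
  exact: IH.
exact.
Qed.

Lemma ST_total (X : HDA) (al : hpath X) : exists t, ST al t.
Proof.
have entry j : j < size (psteps al) -> exists e, ST_entry al j.+1 e.
  move=> lt_j.
  have [[i|i] em] : exists m, dmap_at al j.+1 = Some m.
  - rewrite /dmap_at; elim: (psteps al) j lt_j => [//|[m y] s IH] [|j] //=.
      by exists m.
    exact: IH.
  - have /= [lt_i _] := step_at em.
    by eexists; apply: EntryUp em _; exists lt_i.
  have /= [lt_i _] := step_at em; have [k st] := start_ex em.
  by eexists; apply: EntryDown em _ st; exists lt_i.
suff [t sz ht] : exists2 t : seq st_event, size t = size (psteps al) &
    forall j e, onth t j = Some e -> ST_entry al j.+1 e by exists t.
elim: (size _) entry => [|n IH] entry; first by exists [::] => // -[].
have [j lt_j|t sz ht] := IH; first by apply: entry; apply: ltnW.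
have [e he] := entry n (ltnSn n).
exists (rcons t e); first by rewrite size_rcons sz.
move=> j e'; rewrite -cats1 onth_cat; case: ifP => [_|]; first exact: ht.
move=> ge_j; have [lt_nj|] := ltnP (size t) j.
  by rewrite onth_default //=; lia.
move=> le_j; have -> : j = n by lia.
by rewrite sz subnn => -[<-].
Qed.

Lemma ST_functional (X : HDA) (al : hpath X) t t' : ST al t -> ST al t' -> t = t'.
Proof.
move=> [sz ht] [sz' ht']; have := etrans sz (esym sz').
have {sz sz' ht ht'} : forall j e e', onth t j = Some e -> onth t' j = Some e' -> e = e'.
  move=> j e e' /ht h /ht' h'.
  case: h h' => [i l em hl|i l k em hl st] [i' l' em' hl'|i' l' k' em' hl' st'];
    move: (em'); rewrite em => -[] // ei; subst i'; rewrite (has_label_fun hl hl') //.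
  by rewrite (start_fun st st').
elim: t t' => [|e t IH] [|e' t'] //= he [sz].
congr cons; first by apply: (he 0).
by apply: IH => // j; apply: (he j.+1).
Qed.

Definition same_ST (Y Z : HDA) (al : hpath Y) (be : hpath Z) : Prop :=
  exists2 t, ST al t & ST be t.

(* The symbols of I, in the order: subsumed by, subsumes, similar, has prefix. *)
Inductive symb := SymSub | SymSup | SymSim | SymPre.

Definition half_bisimulation (I : pred symb) (Y Z : HDA)
    (R : hpath Y -> hpath Z -> Prop) : Prop :=
  R (path0 Y) (path0 Z) /\
  forall al be, R al be ->
    [/\ same_ST al be,
        forall al', prefix_path al al' ->
          exists2 be', prefix_path be be' & R al' be'
      & [/\ I SymSub -> forall l al', subsumed l al al' ->
              exists2 be', subsumed l be be' & R al' be',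
            I SymSup -> forall l al', subsumed l al' al ->
              exists2 be', subsumed l be' be & R al' be',
            I SymSim -> forall l al', similar l al' al ->
              exists2 be', similar l be' be & R al' be'
          & I SymPre -> forall al', prefix_path al' al ->
              exists2 be', prefix_path be' be & R al' be']].

Definition bisimulation (I : pred symb) (Y Z : HDA)
    (R : hpath Y -> hpath Z -> Prop) : Prop :=
  half_bisimulation I R /\ half_bisimulation I (fun be al => R al be).

Definition bisimilar (I : pred symb) (Y Z : HDA) : Prop :=
  exists R : hpath Y -> hpath Z -> Prop, bisimulation I R.

End Box.

Definition reST : pred symb := fun s =>
  match s with SymSim | SymPre => true | SymSub | SymSup => false end.

Definition ureST : pred symb := fun s =>
  match s with SymSup | SymSim | SymPre => true | SymSub => false end.

(* Main.v *)
(* A graph with labelled edges spans a precubical set, whose cells over U are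
   the maps {0,1}^U -> vertices that send each cube edge to an edge of the
   graph with the same label.  Take the graph with edges
     O -b-> V,  O -a-> P,  P -b-> W_i,
     V -a-> W_j,  V -c-> U_j,  W_j -c-> Z_j,  U_j -a-> Z_j   (j = 0, 1),
     U_1 -d-> T,
   where i is a parameter; the two HDAs are those for i = 1 and i = 0.  They
   differ only in the square Q on a and b at O, which ends in W_i.

   On a path b^+ a^+ b^- c^+ through Q, the subsequent square on a and c is the
   one at V with index i, but similarity cannot bring c before a, since the end
   of b lies between them; hence d never tells the two indices apart, and the
   relation that is the identity on paths avoiding Q, and exchanges the indices
   0 and 1 on paths avoiding V, U_j and T, is a reST-bisimulation.
   Sequentializing Q gives b^+ b^- a^+ c^+, which is similar to
   b^+ b^- c^+ a^+; its prefix b^+ b^- c^+ can be continued by c^- d^+ exactly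
   when the index is 1. *)

From mathcomp Require Import all_boot.
From mathcomp Require Import zify.
From Stdlib Require Import FunctionalExtensionality PropExtensionality ProofIrrelevance.
Require Import Defs.

Set Implicit Arguments.
Unset Strict Implicit.
Unset Printing Implicit Defensive.

(** * Precubical sets spanned by labelled graphs *)

Section Cube.
Variable Sigma : Type.
Implicit Types U V W : conclist Sigma.

(** Places the corners of {0,1}^U among those of {0,1}^V: coordinates outside the image of [h] are
    frozen at the value that [heps h] prescribes. *)
Definition push U V (h : hom U V) (p : 'I_(cdim U) -> bool) : 'I_(cdim V) -> bool :=
  fun t => if [pick s | hf h s == t] is Some s then p s else heps h t == Some true.

Lemma push_im U V (h : hom U V) p s : push h p (hf h s) = p s.
Proof.
rewrite /push; case: pickP => [s' /eqP /hf_inj -> //|/(_ s)].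
by rewrite eqxx.
Qed.

Lemma push_nim U V (h : hom U V) p t :
  (forall s, hf h s <> t) -> push h p t = (heps h t == Some true).
Proof. by move=> nim; rewrite /push; case: pickP => // s /eqP /nim. Qed.

Lemma push_id U p : push (hid U) p = p.
Proof. by apply: functional_extensionality => t; exact: (push_im (hid U) p t). Qed.

Lemma push_comp U V W (g : hom V W) (f : hom U V) p :
  push (hcomp g f) p = push g (push f p).
Proof.
apply: functional_extensionality => u.
case: (pickP (fun t => hf g t == u)) => [t /eqP <-|nimg]; last first.
  have nim t : hf g t <> u by move/eqP; rewrite nimg.
  by rewrite !push_nim //= ?comp_eps_nim // => s; apply: nim.
rewrite push_im; case: (pickP (fun s => hf f s == t)) => [s /eqP <-|nimf].
  by rewrite push_im; apply: (push_im (hcomp g f)).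
have nim s : hf f s <> t by move/eqP; rewrite nimf.
rewrite !push_nim //= ?comp_eps_im // => s.
by move/hf_inj; apply: nim.
Qed.

Definition raise n (p : 'I_n -> bool) (s : 'I_n) : 'I_n -> bool :=
  fun t => (t == s) || p t.

Lemma push_raise U V (h : hom U V) p s :
  push h (raise p s) = raise (push h p) (hf h s).
Proof.
apply: functional_extensionality => t; rewrite [RHS]/raise.
case: (pickP (fun s => hf h s == t)) => [s' /eqP <-|nimh].
  by rewrite !push_im (inj_eq (@hf_inj _ _ _ h)).
have nim s' : hf h s' <> t by move/eqP; rewrite nimh.
by rewrite !push_nim //; case: (t =P hf h s) => // e; case: (nim s).
Qed.

Lemma push_coface_same k V (i : 'I_(cdim V)) p : push (coface k i) p i = k.
Proof.
rewrite push_nim /= ?eqxx; first by case: k.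
by move=> s /eqP; rewrite eq_sym (negbTE (neq_lift _ _)).
Qed.

Lemma push_coface_const k V (i : 'I_(cdim V)) k' :
  push (coface k i) (fun=> k') = fun t => if t == i then k else k'.
Proof.
apply: functional_extensionality => t.
case: (unliftP i t) => [s ->|->]; last by rewrite push_coface_same eqxx.
by rewrite (push_im (coface k i)) eq_sym (negbTE (neq_lift _ _)).
Qed.

End Cube.

(** * Cube maps into a labelled graph *)

Section GraphHDA.
Variables (Sigma T : Type).

(** Validity is kept out of this type, so that cells over different edge relations share one type
    and can be compared by plain equality. *)
Definition rcell := {U : conclist Sigma & ('I_(cdim U) -> bool) -> T}.
Implicit Types (r : rcell) (E : T -> Sigma -> T -> Prop).

Definition bot r : T := tagged r (fun=> false).
Definition top r : T := tagged r (fun=> true).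

Definition valid E r := forall p s, p s = false ->
  E (tagged r p) (clab s) (tagged r (raise p s)).

Definition rface k r (i : 'I_(cdim (tag r))) : rcell :=
  existT (fun U : conclist Sigma => ('I_(cdim U) -> bool) -> T) (face_conclist i)
    (fun p => tagged r (push (coface k i) p)).

Definition is_rface k r i r' :=
  exists lt_i : i < cdim (tag r), r' = rface k (Ordinal lt_i).

Definition rlabel r i (l : Sigma) :=
  exists lt_i : i < cdim (tag r), clab (Ordinal lt_i) = l.

Definition rstep r phi r' :=
  match phi with
  | D0 i => is_rface false r' i r
  | D1 i => is_rface true r i r'
  end.

Fixpoint rsteps r (s : seq (dmap * rcell)) : Prop :=
  if s is (phi, r') :: s' then rstep r phi r' /\ rsteps r' s' else True.

Lemma rsteps_cat r s1 s2 :
  rsteps r (s1 ++ s2) <-> rsteps r s1 /\ rsteps (last r (unzip2 s1)) s2.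
Proof.
elim: s1 r => [|[m y] s1 IH] r /=; first by split=> [|[]].
by rewrite IH; split=> [[? [? ?]]|[[? ?] ?]].
Qed.

Lemma valid_out E r (s : 'I_(cdim (tag r))) :
  valid E r -> exists u, E (bot r) (clab s) u.
Proof. by move=> v; eexists; apply: v. Qed.

Lemma raise_but n (s : 'I_n) : raise (fun t => t != s) s = fun=> true.
Proof. by apply: functional_extensionality => t; rewrite /raise orbN. Qed.

Lemma valid_in E r (s : 'I_(cdim (tag r))) :
  valid E r -> exists u, E u (clab s) (top r).
Proof.
move=> /(_ (fun t => t != s) s); rewrite eqxx raise_but => v.
by eexists; apply: v.
Qed.

(** Raising the zero coordinates one by one is a walk along edges from the corner [p] to the top
    corner; the induction is on the number of zero coordinates. *)
Lemma valid_forward E (P : T -> Prop) r p : valid E r ->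
  (forall u l u', E u l u' -> P u -> P u') -> P (tagged r p) -> P (top r).
Proof.
move=> v cl; have [n] := ubnP #|[pred s | ~~ p s]|; elim: n p => // n IH p lt_n Pp.
case: (pickP [pred s | ~~ p s]) => [s /= /negbTE ps|all_p]; last first.
  suff e : p = fun=> true by move: Pp; rewrite e.
  by apply: functional_extensionality => s; apply/negbFE/all_p.
apply: (IH (raise p s)); last exact: cl (v _ _ ps) Pp.
rewrite ltnS in lt_n; apply: leq_trans lt_n; apply: proper_card; apply/properP; split.
  by apply/subsetP => t; rewrite !inE negb_or => /andP[].
by exists s; rewrite !inE ?ps // /raise eqxx.
Qed.

Lemma rlabel_ex k r i r' : is_rface k r i r' -> exists l, rlabel r i l.
Proof. by case=> lt_i _; eexists; exists lt_i. Qed.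

(** The top of the lower face [r] is the corner of [r'] just below its top in direction [i], whence
    the edge labelled [l]. The last conjunct is the edge in direction [i] at the bottom corner. *)
Lemma up_ends E r r' i l : valid E r' -> is_rface false r' i r -> rlabel r' i l ->
  [/\ bot r = bot r', E (top r) l (top r') & exists u, E (bot r') l u].
Proof.
move=> v [lt_i ->] [lt_i' <-]; rewrite (bool_irrelevance lt_i' lt_i).
split; last exact: valid_out.
- rewrite /bot /= push_coface_const; congr (tagged r' _).
  by apply: functional_extensionality => t; case: ifP.
- have := v (fun t => t != Ordinal lt_i) (Ordinal lt_i).
  rewrite eqxx raise_but => /(_ erefl); congr (E (tagged r' _) _ _).
  by rewrite push_coface_const; apply: functional_extensionality => t; case: eqP.
Qed.

(** Dually, the bottom of the upper face [r'] is the corner of [r] just above its bottom in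
    direction [i]. *)
Lemma down_ends E r r' i l : valid E r -> is_rface true r i r' -> rlabel r i l ->
  [/\ top r' = top r, E (bot r) l (bot r') & exists u, E u l (top r)].
Proof.
move=> v [lt_i ->] [lt_i' <-]; rewrite (bool_irrelevance lt_i' lt_i).
split; last exact: valid_in.
- rewrite /top /= push_coface_const; congr (tagged r _).
  by apply: functional_extensionality => t; case: ifP.
- have := v (fun=> false) (Ordinal lt_i) erefl; congr (E _ _ (tagged r _)).
  rewrite push_coface_const; apply: functional_extensionality => t.
  by rewrite /raise orbF; case: eqP.
Qed.

Definition rmap (h : T -> T) r : rcell :=
  existT (fun U : conclist Sigma => ('I_(cdim U) -> bool) -> T) (tag r)
    (fun p => h (tagged r p)).

Lemma rstep_map h r phi r' : rstep r phi r' -> rstep (rmap h r) phi (rmap h r').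
Proof. by case: phi => i /= [lt_i ->]; exists lt_i. Qed.

Definition rmaps h (s : seq (dmap * rcell)) := [seq (x.1, rmap h x.2) | x <- s].

Lemma rsteps_map h r s : rsteps r s -> rsteps (rmap h r) (rmaps h s).
Proof.
elim: s r => [|[phi r'] s IH] r //= [st /IH ?]; split=> //.
exact: rstep_map st.
Qed.

Lemma rcell_eq n (l l' : 'I_n -> Sigma) (f f' : ('I_n -> bool) -> T) :
  l =1 l' -> f =1 f' ->
  existT (fun U : conclist Sigma => ('I_(cdim U) -> bool) -> T) (Conclist l) f =
  existT (fun U : conclist Sigma => ('I_(cdim U) -> bool) -> T) (Conclist l') f'.
Proof.
by move=> /functional_extensionality -> /functional_extensionality ->.
Qed.

Lemma valid_push E U V (h : hom U V) f :
  valid E (existT (fun W : conclist Sigma => ('I_(cdim W) -> bool) -> T) V f) ->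
  valid E (existT (fun W : conclist Sigma => ('I_(cdim W) -> bool) -> T) U
             (fun p => f (push h p))).
Proof.
move=> v p s ps /=; rewrite push_raise -(hf_lab h).
by apply: (v (push h p) (hf h s)); rewrite push_im.
Qed.

Definition graph_set E : precubical Sigma.
Proof.
refine (@Precubical Sigma
  (fun U => {f : ('I_(cdim U) -> bool) -> T | valid E (existT _ U f)})
  (fun U V h x => exist (fun f => valid E (existT _ U f))
                    (fun p => sval x (push h p)) (@valid_push E U V h _ (svalP x))) _ _).
- move=> U [f v] /=; apply: eq_exist_uncurried => /=.
  have e : (fun p => f (push (hid U) p)) = f.
    by apply: functional_extensionality => p; rewrite push_id.
  by exists e; apply: proof_irrelevance.
- move=> U V W g h [f v] /=; apply: eq_exist_uncurried => /=.
  have e : (fun p => f (push (hcomp g h) p)) = (fun p => f (push g (push h p))).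
    by apply: functional_extensionality => p; rewrite push_comp.
  by exists e; apply: proof_irrelevance.
Defined.

Definition raw E (x : cell (graph_set E)) : rcell :=
  existT (fun U : conclist Sigma => ('I_(cdim U) -> bool) -> T) (tag x) (sval (tagged x)).

Lemma raw_valid E (x : cell (graph_set E)) : valid E (raw x).
Proof. by case: x => U [f v]. Qed.

Lemma raw_inj E : injective (@raw E).
Proof.
move=> [U [f v]] [U' [f' v']] e.
have mk r (w w' : valid E r) :
    existT (fun U => graph_set E U) (tag r)
      (exist (fun f => valid E (existT _ (tag r) f)) (tagged r) w) =
    existT (fun U => graph_set E U) (tag r)
      (exist (fun f => valid E (existT _ (tag r) f)) (tagged r) w').
  by rewrite (proof_irrelevance _ w w').
(* With two raw cells as variables, their equality can be eliminated although the validity proofs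
   depend on them. *)
have mk' r r' w w' : r = r' ->
    existT (fun U => graph_set E U) (tag r)
      (exist (fun f => valid E (existT _ (tag r) f)) (tagged r) w) =
    existT (fun U => graph_set E U) (tag r')
      (exist (fun f => valid E (existT _ (tag r') f)) (tagged r') w').
  by move=> er; subst r'; apply: mk.
exact: (mk' _ _ v v' e).
Qed.

Lemma raw_ex E r : valid E r -> exists x : cell (graph_set E), raw x = r.
Proof.
case: r => U f v; pose x : graph_set E U := exist (fun f => valid E (existT _ U f)) f v.
by exists (existT (fun U => graph_set E U) U x).
Qed.

Lemma step_raw E (x y : cell (graph_set E)) phi :
  step_ok x phi y <-> rstep (raw x) phi (raw y).
Proof.
case: phi => i; split=> -[lt_i e]; exists lt_i; by [rewrite e | apply: raw_inj; exact: e].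
Qed.

End GraphHDA.

(** * Paths of graph HDAs as sequences of raw cells *)

Section GraphPaths.
Variables (Sigma T : Type).
Implicit Types (r : rcell Sigma T) (E : T -> Sigma -> T -> Prop) (u : T).

Definition seq_conclist (ls : seq Sigma) : conclist Sigma := Conclist (tnth (in_tuple ls)).

Definition rcube ls (f : ('I_(size ls) -> bool) -> T) : rcell Sigma T :=
  existT (fun U : conclist Sigma => ('I_(cdim U) -> bool) -> T) (seq_conclist ls) f.

Definition rpoint u := @rcube [::] (fun=> u).

Lemma valid_point E u : valid E (rpoint u).
Proof. by move=> p [s lt_s]. Qed.

Definition graph_hda E u : HDA Sigma :=
  @MkHDA Sigma (graph_set E)
    (existT (fun U => graph_set E U) (seq_conclist [::])
       (exist (fun f => valid E (existT _ (seq_conclist [::]) f)) (fun=> u)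
          (@valid_point E u)))
    erefl.

Section Paths.
Variables (E : T -> Sigma -> T -> Prop) (u : T).
Implicit Types al be : hpath (graph_hda E u).

Definition raws (s : seq (dmap * cell (graph_set E))) : seq (dmap * rcell Sigma T) :=
  [seq (x.1, raw x.2) | x <- s].

Definition rpath al : seq (dmap * rcell Sigma T) := raws (psteps al).

Lemma raws_inj : injective raws.
Proof.
apply: inj_map => -[m x] [m' x'] e.
by move: (congr1 fst e) (congr1 snd e) => /= -> /raw_inj ->.
Qed.

Lemma steps_raw (x : cell (graph_set E)) s :
  steps_ok x s <-> rsteps (raw x) (raws s).
Proof.
elim: s x => [|[m y] s IH] x //=.
by split=> -[/step_raw ? /IH ?].
Qed.

Lemma rpath_ok al : rsteps (rpoint u) (rpath al).
Proof. by have /steps_raw := psteps_ok al. Qed.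

Lemma rpath_valid al : List.Forall (fun x => valid E x.2) (rpath al).
Proof. by rewrite /rpath; elim: (psteps al) => [|x s IH]; constructor=> //; apply: raw_valid. Qed.

Lemma path_ex s : rsteps (rpoint u) s -> List.Forall (fun x => valid E x.2) s ->
  exists al, rpath al = s.
Proof.
move=> st v; have [s' es] : exists s', raws s' = s.
  elim: {st} v => [|[m r] s2 /raw_ex [x ex] _ [s' <-]]; first by exists [::].
  by exists ((m, x) :: s'); rewrite /raws /= ex.
have ok : steps_ok (hda_init (graph_hda E u)) s' by apply/steps_raw; rewrite es.
by exists (Path ok).
Qed.

Lemma rpath_prefix al be s : rpath be = rpath al ++ s -> prefix_path al be.
Proof.
rewrite /prefix_path /rpath => e; exists (drop (size (psteps al)) (psteps be)).
apply: raws_inj; rewrite /raws map_cat map_drop -/(raws _) e.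
by rewrite -[in drop _ _](size_map (fun x => (x.1, raw x.2))) drop_size_cat.
Qed.

Lemma prefix_rpath al be : prefix_path al be -> exists s, rpath be = rpath al ++ s.
Proof. by case=> s e; exists (raws s); rewrite /rpath e /raws map_cat. Qed.

Lemma map_split A B (f : A -> B) s t1 t2 : map f s = t1 ++ t2 ->
  exists s1 s2, [/\ s = s1 ++ s2, map f s1 = t1 & map f s2 = t2].
Proof.
move=> e; exists (take (size t1) s), (drop (size t1) s).
by rewrite cat_take_drop map_take map_drop e take_size_cat // drop_size_cat.
Qed.

Definition rreplaced (P : dmap -> dmap -> dmap -> dmap -> Prop) l
    (s s' : seq (dmap * rcell Sigma T)) : Prop :=
  exists p q p' q' x x' y s1 s2,
    [/\ P p q p' q', l = (size s1).+1,
        s = s1 ++ [:: (p, x), (q, y) & s2] &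
        s' = s1 ++ [:: (p', x'), (q', y) & s2]].

Lemma replaced_raw P l al be : replaced P l al be <-> rreplaced P l (rpath al) (rpath be).
Proof.
split=> -[p [q [p' [q' [x [x' [y [s1 [s2 [HP -> ea eb]]]]]]]]]].
  exists p, q, p', q', (raw x), (raw x'), (raw y), (raws s1), (raws s2).
  by rewrite size_map /rpath ea eb /raws !map_cat.
have [t1 [t [et e1]]] := map_split ea.
case: t et => [//|[p0 z0] [//|[q0 w0] t2]] et [ep ez eq ew e2].
have [t1' [t' [et' e1']]] := map_split eb.
case: t' et' => [//|[p0' z0'] [//|[q0' w0'] t2']] et' [ep' ez' eq' ew' e2'].
(* Parts of the two paths that agree as raw sequences agree as cells, since [raw] is injective. *)
move: et'; have -> : t1' = t1 by apply: raws_inj; rewrite /raws e1.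
have -> : t2' = t2 by apply: raws_inj; rewrite /raws e2.
have -> : w0' = w0 by apply: raw_inj; rewrite ew.
subst=> et'; do 9 eexists; split; [exact: HP| |exact: et|exact: et'].
by rewrite size_map.
Qed.

Lemma dmap_at_raw al j : dmap_at al j =
  if j is j'.+1 then onth (unzip1 (rpath al)) j' else None.
Proof. by case: j => //= j; rewrite /rpath /unzip1 /raws -map_comp. Qed.

Lemma cell_at_raw al j :
  raw (cell_at al j) = nth (rpoint u) (rpoint u :: unzip2 (rpath al)) j.
Proof.
rewrite /cell_at -/(raw (hda_init (graph_hda E u))).
have -> : unzip2 (rpath al) = map (@raw _ _ E) (unzip2 (psteps al)).
  by rewrite /rpath /unzip2 /raws -!map_comp.
have -> : rpoint u = raw (hda_init (graph_hda E u)) by [].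
rewrite -map_cons; elim: (_ :: _) j => [|x s IH] [|j] //=.
Qed.

End Paths.

(** * Images of paths under a vertex map *)

Lemma rmaps_cat h (s t : seq (dmap * rcell Sigma T)) :
  rmaps h (s ++ t) = rmaps h s ++ rmaps h t.
Proof. exact: map_cat. Qed.

Lemma rreplaced_map h P l (s s' : seq (dmap * rcell Sigma T)) :
  rreplaced P l s s' -> rreplaced P l (rmaps h s) (rmaps h s').
Proof.
move=> [p [q [p' [q' [x [x' [y [s1 [s2 [HP -> -> ->]]]]]]]]]].
exists p, q, p', q', (rmap h x), (rmap h x'), (rmap h y), (rmaps h s1), (rmaps h s2).
by rewrite size_map /rmaps !map_cat.
Qed.

Section Mates.
Variables (E E' : T -> Sigma -> T -> Prop) (u u' : T) (h : T -> T).
Implicit Types (al : hpath (graph_hda E u)) (be : hpath (graph_hda E' u')).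

(** The two paths lie in different HDAs, so they are related through their raw sequences. *)
Definition mate al be := rpath be = rmaps h (rpath al).

Hypothesis hu : h u = u'.

Lemma mate_ex al : List.Forall (fun x => valid E' (rmap h x.2)) (rpath al) ->
  exists be, mate al be.
Proof.
move=> v; apply: path_ex.
  by have := rsteps_map h (rpath_ok al); rewrite -hu.
by elim: v => [|x s vx _ IH]; constructor.
Qed.

Lemma mate_prefix al be al' be' :
  mate al be -> mate al' be' -> prefix_path al al' -> prefix_path be be'.
Proof.
move=> m m' /prefix_rpath [s e]; apply: (@rpath_prefix _ _ _ _ (rmaps h s)).
by rewrite m m' e rmaps_cat.
Qed.

Lemma mate_replaced P l al be al' be' : mate al be -> mate al' be' ->
  replaced P l al al' -> replaced P l be be'.
Proof.
move=> m m' /replaced_raw r; apply/replaced_raw.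
by rewrite m m'; apply: rreplaced_map.
Qed.

Lemma mate_similar l al be al' be' : mate al be -> mate al' be' ->
  similar l al al' -> similar l be be'.
Proof.
move=> m m'; case=> r; [apply: Or41|apply: Or42|apply: Or43|apply: Or44];
  by [apply: mate_replaced r | apply: mate_replaced r].
Qed.

Lemma mate_dmap_at al be j : mate al be -> dmap_at be j = dmap_at al j.
Proof.
by move=> m; rewrite !dmap_at_raw m; case: j => // j; rewrite /unzip1 /rmaps -map_comp.
Qed.

Lemma mate_cell_at al be j : mate al be -> raw (cell_at be j) = rmap h (raw (cell_at al j)).
Proof.
move=> m; rewrite !cell_at_raw m -hu.
have -> : unzip2 (rmaps h (rpath al)) = map (rmap h) (unzip2 (rpath al)).
  by rewrite /rmaps /unzip2 -!map_comp.
have -> : rpoint (h u) = rmap h (rpoint u) by [].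
by rewrite -map_cons; elim: (_ :: _) j => [|x s IH] [|j] //=.
Qed.

Lemma mate_label al be j i l : mate al be ->
  has_label (cell_at al j) i l -> has_label (cell_at be j) i l.
Proof.
move=> m; rewrite -[has_label (cell_at be j) i l]/(rlabel (raw (cell_at be j)) i l).
by rewrite (mate_cell_at _ m).
Qed.

(** By [startE], the start position is computed from the coface maps before the step and the index
    of the step, none of which [h] affects. *)
Lemma mate_start al be j k : mate al be -> start al j k -> start be j k.
Proof.
move=> m st; have [i e ek] := startE st; rewrite -(mate_dmap_at _ m) in e.
have [k' st'] := start_ex e; have [i' e' ek'] := startE st'.
suff -> : k = k' by [].
move: e'; rewrite ek ek' e => -[<-]; congr (start_of (rev (take _ _)) _).
have unz D w (ga : hpath (graph_hda D w)) : unzip1 (psteps ga) = unzip1 (rpath ga).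
  by rewrite /rpath /raws /unzip1 -map_comp.
by rewrite !unz m /rmaps /unzip1 -map_comp.
Qed.

(** An ST-trace records only directions of steps, labels and start positions, and moving vertices by
    [h] changes none of them. *)
Lemma mate_ST al be : mate al be -> same_ST al be.
Proof.
move=> m; have [t [sz ht]] := ST_total al; exists t => //; split.
  have -> : size (psteps be) = size (rpath be) by rewrite size_map.
  by rewrite m !size_map.
move=> j e /ht [i l em hl|i l k em hl st]; rewrite -(mate_dmap_at _ m) in em.
  exact: EntryUp em (mate_label m hl).
exact: EntryDown em (mate_label m hl) (mate_start m st).
Qed.

End Mates.
End GraphPaths.

(** * Edges and squares as explicit cells *)

Section SmallCubes.
Variables (Sigma T : Type) (E : T -> Sigma -> T -> Prop).

Definition redge l (x y : T) : rcell Sigma T :=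
  @rcube _ _ [:: l] (fun p => if p ord0 then y else x).

(** The corner [x] is the bottom, [y] is reached from it by [l], [z] by [m], and [w] is the top. *)
Definition rsquare l m (x y z w : T) : rcell Sigma T :=
  @rcube _ _ [:: l; m] (fun p =>
    if p (@Ordinal 2 0 isT) then if p (@Ordinal 2 1 isT) then w else y
    else if p (@Ordinal 2 1 isT) then z else x).

Lemma valid_edge l x y : E x l y -> valid E (redge l x y).
Proof.
move=> e p s; rewrite /= (tnth_nth l) /raise; case: s => [[|//] lt_s] /=.
have -> : Ordinal lt_s = ord0 by apply: val_inj.
by move=> ->.
Qed.

Lemma valid_square l m x y z w : E x l y -> E z l w -> E x m z -> E y m w ->
  valid E (rsquare l m x y z w).
Proof.
move=> exy ezw exz eyw p s; rewrite /= (tnth_nth l) /raise.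
case: s => [[|[|//]] lt_s] /=.
  have -> : Ordinal lt_s = @Ordinal 2 0 isT by apply: val_inj.
  by move=> ->; case: (p _).
have -> : Ordinal lt_s = @Ordinal 2 1 isT by apply: val_inj.
by move=> ->; case: (p _).
Qed.

(** The hypothesis is an equation between numbers because the concrete ordinals in edges and squares
    are not syntactically of the form [lift i s]. *)
Lemma push_coface_lift k (V : conclist Sigma) (i t : 'I_(cdim V)) s p :
  t = lift i s :> nat -> push (coface k i) p t = p s.
Proof.
by move=> e; rewrite (_ : t = lift i s) ?(push_im (coface k i)) //; apply: val_inj.
Qed.

Lemma edge_face k l x y : is_rface k (redge l x y) 0 (rpoint Sigma (if k then y else x)).
Proof.
have lt0 : 0 < size [:: l] by [].
exists lt0; apply: rcell_eq => [[//]|p] /=.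
rewrite (_ : ord0 = Ordinal lt0) ?push_coface_same //; exact: val_inj.
Qed.

Lemma square_face0 k l m x y z w :
  is_rface k (rsquare l m x y z w) 0 (redge m (if k then y else x) (if k then w else z)).
Proof.
have lt0 : 0 < size [:: l; m] by [].
exists lt0; apply: rcell_eq => [[[|//] lt_s]|p] /=.
  by rewrite !(tnth_nth l).
have -> : @Ordinal 2 0 isT = Ordinal lt0 by apply: val_inj.
rewrite push_coface_same.
rewrite (@push_coface_lift k (seq_conclist [:: l; m]) _ (@Ordinal 2 1 isT) (ord0 : 'I_1)) //.
by case: k.
Qed.

Lemma square_face1 k l m x y z w :
  is_rface k (rsquare l m x y z w) 1 (redge l (if k then z else x) (if k then w else y)).
Proof.
have lt1 : 1 < size [:: l; m] by [].
exists lt1; apply: rcell_eq => [[[|//] lt_s]|p] /=.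
  by rewrite !(tnth_nth l).
have -> : @Ordinal 2 1 isT = Ordinal lt1 by apply: val_inj.
rewrite push_coface_same.
rewrite (@push_coface_lift k (seq_conclist [:: l; m]) _ (@Ordinal 2 0 isT) (ord0 : 'I_1)) //.
Qed.

Lemma edge_label l x y : rlabel (redge l x y) 0 l.
Proof. by exists (isT : 0 < size [:: l]); rewrite /= (tnth_nth l). Qed.

Lemma square_label0 l m x y z w : rlabel (rsquare l m x y z w) 0 l.
Proof. by exists (isT : 0 < size [:: l; m]); rewrite /= (tnth_nth l). Qed.

Lemma square_label1 l m x y z w : rlabel (rsquare l m x y z w) 1 m.
Proof. by exists (isT : 1 < size [:: l; m]); rewrite /= (tnth_nth l). Qed.

End SmallCubes.

(** * Labelled steps of paths *)

Section LabelledSteps.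
Variable Sigma : Type.

(** Here [j] counts from 0: the step is the one between the cells numbered [j] and [j.+1], and its
    label is read in the larger of the two, which is the later one here and the earlier one in
    [down_at]. *)
Definition up_at (X : HDA Sigma) (al : hpath X) j l :=
  exists2 i, dmap_at al j.+1 = Some (D0 i) & has_label (cell_at al j.+1) i l.

Definition down_at (X : HDA Sigma) (al : hpath X) j l :=
  exists2 i, dmap_at al j.+1 = Some (D1 i) & has_label (cell_at al j) i l.

Lemma same_ST_size (X Y : HDA Sigma) (al : hpath X) (be : hpath Y) :
  same_ST al be -> size (psteps be) = size (psteps al).
Proof. by move=> [t [<- _] [<- _]]. Qed.

Lemma dmap_at_lt (X : HDA Sigma) (al : hpath X) j phi :
  dmap_at al j.+1 = Some phi -> j < size (psteps al).
Proof. by move=> /dmap_atP [x]; case: ltnP => // /onth_default ->. Qed.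

Lemma onth_ex A (s : seq A) j : j < size s -> exists x, onth s j = Some x.
Proof. by elim: s j => [|x s IH] [|j] //=; [exists x | apply: IH]. Qed.

(** The trace entry fixes the direction and the label of the step, but not its index, which may
    differ in the two paths; hence the existential in [up_at]. *)
Lemma same_ST_up (X Y : HDA Sigma) (al : hpath X) (be : hpath Y) j l :
  same_ST al be -> up_at al j l -> up_at be j l.
Proof.
move=> [t [sz ht] [_ ht']] [i e hl].
have := dmap_at_lt e; rewrite -sz => /onth_ex [en en_j].
have h0 := ht _ _ en_j; case: h0 en_j => [i' l' e' hl'|i' l' k e' _ _] en_j; last by rewrite e in e'.
have ei : i' = i by move: e'; rewrite e => -[].
rewrite ei in hl'; rewrite (has_label_fun hl' hl) in en_j.
move E : (STplus l) (ht' _ _ en_j) => en' h.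
by case: h E => // i2 l2 e2 hl2 [->]; exists i2.
Qed.

Lemma same_ST_down (X Y : HDA Sigma) (al : hpath X) (be : hpath Y) j l :
  same_ST al be -> down_at al j l -> down_at be j l.
Proof.
move=> [t [sz ht] [_ ht']] [i e hl].
have := dmap_at_lt e; rewrite -sz => /onth_ex [en en_j].
have h0 := ht _ _ en_j; case: h0 en_j => [i' l' e' _|i' l' k e' hl' _] en_j; first by rewrite e in e'.
have ei : i' = i by move: e'; rewrite e => -[].
rewrite ei in hl'; rewrite (has_label_fun hl' hl) in en_j.
move E : (STend l k) (ht' _ _ en_j) => en' h.
by case: h E => // i2 l2 k2 e2 hl2 _ [-> _]; exists i2.
Qed.

Lemma replaced_cell_at (X : HDA Sigma) P l (al be : hpath X) j :
  replaced P l al be -> j <> l -> cell_at be j = cell_at al j.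
Proof.
move=> [p [q [p' [q' [x [x' [y [s1 [s2 [_ -> ea eb]]]]]]]]]] ne.
rewrite /cell_at ea eb /unzip2 !map_cat -!cat_cons !nth_cat /= !size_map.
case: ltnP => // le; have -> : j - (size s1).+1 = (j - (size s1).+2).+1 by lia.
by [].
Qed.

Lemma similar_cell_at (X : HDA Sigma) l (al be : hpath X) j :
  similar l al be -> j <> l -> cell_at be j = cell_at al j.
Proof. by case=> h ne; rewrite (replaced_cell_at h ne). Qed.

Lemma prefix_cell_at (X : HDA Sigma) (al be : hpath X) j :
  prefix_path al be -> j <= size (psteps al) -> cell_at be j = cell_at al j.
Proof.
move=> [s e] le; rewrite /cell_at e /unzip2 map_cat -cat_cons nth_cat /= size_map.
by rewrite ltnS le.
Qed.

Section Graph.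
Variables (T : Type) (E : T -> Sigma -> T -> Prop) (u : T).
Implicit Types al : hpath (graph_hda E u).

Lemma up_at_ends al j l : up_at al j l ->
  [/\ bot (raw (cell_at al j)) = bot (raw (cell_at al j.+1)),
      E (top (raw (cell_at al j))) l (top (raw (cell_at al j.+1)))
    & exists w, E (bot (raw (cell_at al j.+1))) l w].
Proof.
move=> [i e hl]; have /step_raw /= st := step_at e.
by apply: up_ends st hl; apply: raw_valid.
Qed.

Lemma down_at_ends al j l : down_at al j l ->
  [/\ top (raw (cell_at al j.+1)) = top (raw (cell_at al j)),
      E (bot (raw (cell_at al j))) l (bot (raw (cell_at al j.+1)))
    & exists w, E w l (top (raw (cell_at al j)))].
Proof.
move=> [i e hl]; have /step_raw /= st := step_at e.
by apply: down_ends st hl; apply: raw_valid.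
Qed.

Lemma up_at_raw al j l i : onth (unzip1 (rpath al)) j = Some (D0 i) ->
  rlabel (nth (rpoint Sigma u) (unzip2 (rpath al)) j) i l -> up_at al j l.
Proof.
move=> e hl; exists i; first by rewrite dmap_at_raw.
by rewrite -[has_label _ i l]/(rlabel (raw (cell_at al j.+1)) i l) cell_at_raw.
Qed.

Lemma down_at_raw al j l i : onth (unzip1 (rpath al)) j = Some (D1 i) ->
  rlabel (nth (rpoint Sigma u) (rpoint Sigma u :: unzip2 (rpath al)) j) i l ->
  down_at al j l.
Proof.
move=> e hl; exists i; first by rewrite dmap_at_raw.
by rewrite -[has_label _ i l]/(rlabel (raw (cell_at al j)) i l) cell_at_raw.
Qed.

End Graph.
End LabelledSteps.

(** * The reST-bisimulation *)

Inductive vtx := VO | VV | VP | VW of bool | VU of bool | VZ of bool | VT.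

Definition vswap x :=
  match x with
  | VW j => VW (~~ j) | VU j => VU (~~ j) | VZ j => VZ (~~ j) | _ => x
  end.

(** Reachability in the union of the two graphs, so that one relation serves both values of the
    parameter. *)
Definition reach x y : bool :=
  match x, y with
  | VO, _ | VV, (VV | VW _ | VU _ | VZ _ | VT) | VP, (VP | VW _ | VZ _) | VT, VT => true
  | VW j, (VW k | VZ k) | VU j, (VU k | VZ k) | VZ j, VZ k => j == k
  | VU j, VT => j
  | _, _ => false
  end.

(* The relations [fixed] and [tame] describe a cell by its bottom and top
   vertices. *)
Definition fixed x y : bool :=
  match x, y with
  | VO, (VO | VV | VP) | VP, VP => true
  | _, _ => false
  end.

(* [tame true] holds of the cells that may be matched with their image under the
   exchange of indices, and [tame false] of those that may be matched with
   themselves.  A path may change sides only while its cells are [fixed]. *)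
Definition tame (g : bool) x y : bool :=
  match g, x, y with
  | true, VO, (VO | VV | VP | VW _) | true, VP, (VP | VW _)
  | true, (VV | VW _), (VW _ | VZ _) | true, (VU _ | VZ _), VZ _ => true
  | true, _, _ => false
  | false, VO, (VO | VV | VP) | false, VP, VP => true
  | false, (VO | VP), _ => false
  | false, _, _ => true
  end.

Definition vmap (g : bool) : vtx -> vtx := if g then vswap else id.

Lemma vmapK g : involutive (vmap g).
Proof. by case: g => // -[] //= j; rewrite negbK. Qed.

Lemma tame_vmap g x y : tame g (vmap g x) (vmap g y) = tame g x y.
Proof. by case: g => //; case: x; case: y. Qed.

(** * The two graphs and the tameness of their cells *)

Section Example.
Variables (Sigma : Type) (a b c d : Sigma).
Hypotheses (ab : a <> b) (ac : a <> c) (ad : a <> d)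
  (bc : b <> c) (bd : b <> d) (cd : c <> d).

Inductive edge (i : bool) : vtx -> Sigma -> vtx -> Prop :=
| EdgeOV : edge i VO b VV
| EdgeOP : edge i VO a VP
| EdgePW : edge i VP b (VW i)
| EdgeVW j : edge i VV a (VW j)
| EdgeVU j : edge i VV c (VU j)
| EdgeWZ j : edge i (VW j) c (VZ j)
| EdgeUZ j : edge i (VU j) a (VZ j)
| EdgeUT : edge i (VU true) d VT.

Local Ltac inv_edge := repeat match goal with
  | H : edge _ _ _ _ |- _ => inversion H; clear H; subst => //
  end; try congruence.

Lemma reachxx x : reach x x.
Proof. by case: x => // j /=. Qed.

Lemma reach_edge i x y l z : reach x y -> edge i y l z -> reach x z.
Proof. by move=> h e; case: e h => [||||j|j|j|]; case: x => [|||k|k|k|] //= /eqP ->. Qed.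

Lemma valid_reach i r p : valid (edge i) r -> reach (tagged r p) (top r).
Proof.
move=> v; apply: (valid_forward v (P := reach (tagged r p))) (reachxx _).
by move=> x l y e h; apply: reach_edge h e.
Qed.

(** The top moves from [y] to [y']. The started event also leaves the bottom [x], which excludes,
    for instance, starting [c] while the bottom is still [O]. The second disjunct is the change of
    side. *)
Lemma tame_up g i x y y' l z : tame g x y -> reach x y ->
  edge i y l y' -> edge i x l z -> tame g x y' || (fixed x y && tame (~~ g) x y').
Proof. by case: g; case: x => [|||j|j|j|]; case: y => [|||k|k|k|] //= _ h e e'; inv_edge. Qed.

Lemma tame_down g i x x' y l z : tame g x y -> reach x' y ->
  edge i x l x' -> edge i z l y -> tame g x' y || (fixed x y && tame (~~ g) x' y).
Proof. by case: g; case: x => [|||j|j|j|]; case: y => [|||k|k|k|] //= _ h e e'; inv_edge. Qed.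

(** Similarity replaces the cell between two consecutive up-steps; this keeps the new cell on the
    side of its neighbours. The next lemma does the same for down-steps. *)
Lemma tame_mid_up g i x y y' y'' l l' : tame g x y -> edge i y l y' ->
  edge i y' l' y'' -> tame g x y'' -> tame g x y'.
Proof. by case: g; case: x => [|||j|j|j|]; case: y => [|||k|k|k|] //= _ e e' h; inv_edge. Qed.

Lemma tame_mid_down g i x x' x'' y l l' : tame g x y -> edge i x l x' ->
  edge i x' l' x'' -> tame g x'' y -> reach x'' y -> tame g x' y.
Proof.
by case: g; case: x => [|||j|j|j|]; case: y => [|||k|k|k|] //= _ e e' h h'; inv_edge.
Qed.

Lemma fixed_up i x y y' l : reach x y -> edge i y l y' -> fixed x y' -> fixed x y.
Proof. by case: x => [|||j|j|j|]; case: y => [|||k|k|k|] //= _ e h; inv_edge. Qed.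

Lemma fixed_down i x x' y l : reach x y -> edge i x l x' -> fixed x' y -> fixed x y.
Proof. by case: x => [|||j|j|j|]; case: y => [|||k|k|k|] //= _ e h; inv_edge. Qed.

(** The only edges that [vmap g] does not carry into the other graph are the one labelled [d] for
    the exchange and the one from [P] to [W_i] for the identity. Tameness of the cell with bottom
    [x] and top [y] rules out both. *)
Lemma tame_edge g i u l u' x y z w : edge i u l u' -> edge i x l z ->
  edge i w l y -> reach u' y -> tame g x y -> edge (~~ i) (vmap g u) l (vmap g u').
Proof.
move=> e; case: g; last first.
  by case: e => *; try constructor; inv_edge.
by case: e => *; try constructor; inv_edge.
Qed.

Local Notation rcell := (rcell Sigma vtx).
Implicit Types (r : rcell) (s : seq (dmap * rcell)).

Definition all_ends (P : vtx -> vtx -> bool) s :=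
  List.Forall (fun x => P (bot x.2) (top x.2)) s.

Lemma valid_vmap g i r : valid (edge i) r -> tame g (bot r) (top r) ->
  valid (edge (~~ i)) (rmap (vmap g) r).
Proof.
move=> v h p s ps /=; have [z ez] := @valid_out _ _ _ r s v; have [w ew] := @valid_in _ _ _ r s v.
exact: tame_edge (v p s ps) ez ew (valid_reach _ v) h.
Qed.

Lemma fixed_vmap g i r : valid (edge i) r -> fixed (bot r) (top r) -> rmap (vmap g) r = r.
Proof.
(* [fixed VO x] says that [x] is [O], [V] or [P]. The other vertices are closed under edges, so if
   the top of a cell is one of these three, all its corners are, and [vmap g] fixes them. *)
move=> v h; have cl x l y : edge i x l y -> ~~ fixed VO x -> ~~ fixed VO y.
  by move=> e; inv_edge.
have top_r : fixed VO (top r) by move: h; case: (bot _) => //; case: (top _).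
have fix_r p : vmap g (tagged r p) = tagged r p.
  have := @valid_forward _ _ _ (fun x => ~~ fixed VO x) _ p v cl.
  by rewrite top_r; case: g => //=; case: (tagged r p) => //= j /(_ isT).
case: r fix_r {v h top_r} => U f fix_r; apply: eq_existT_uncurried; exists erefl => /=.
by apply: functional_extensionality.
Qed.

Lemma tame_step g i r phi r' : valid (edge i) r -> valid (edge i) r' ->
  rstep r phi r' -> tame g (bot r) (top r) ->
  tame g (bot r') (top r') || (fixed (bot r) (top r) && tame (~~ g) (bot r') (top r')).
Proof.
move=> v v'; case: phi => k st h; have [l hl] := rlabel_ex st.
  have [e1 e2 [z e3]] := up_ends v' st hl.
  rewrite e1 in h *; apply: tame_up e2 e3 => //.
  by rewrite -e1; apply: valid_reach v.
have [e1 e2 [z e3]] := down_ends v st hl.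
rewrite e1 in h *; apply: tame_down e2 e3 => //.
by rewrite -e1; apply: valid_reach v'.
Qed.

Lemma fixed_step i r phi r' : valid (edge i) r -> valid (edge i) r' ->
  rstep r phi r' -> fixed (bot r') (top r') -> fixed (bot r) (top r).
Proof.
move=> v v'; have h := valid_reach (fun=> false) v.
case: phi => k st; have [l hl] := rlabel_ex st.
  by have [e1 e2 _] := up_ends v' st hl; rewrite -e1; apply: fixed_up e2.
by have [e1 e2 _] := down_ends v st hl; rewrite e1; apply: fixed_down e2.
Qed.

Local Notation all_valid i := (List.Forall (fun x => valid (edge i) x.2)).

Lemma valid_last i s : all_valid i s -> valid (edge i) (last (rpoint Sigma VO) (unzip2 s)).
Proof.
have : valid (edge i) (rpoint Sigma VO) by apply: valid_point.
by move: (rpoint _ _) => r v vs; elim: vs r v => //= x s' vx _ IH r _; apply: IH.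
Qed.

Lemma last_ends (P : vtx -> vtx -> bool) s : P VO VO -> all_ends P s ->
  P (bot (last (rpoint Sigma VO) (unzip2 s))) (top (last (rpoint Sigma VO) (unzip2 s))).
Proof.
move=> P0; have : P (bot (rpoint Sigma VO)) (top (rpoint Sigma VO)) by [].
by move: (rpoint _ _) => r v vs; elim: vs r v => //= x s' vx _ IH r _; apply: IH.
Qed.

(** No step leads from a cell that is not fixed to a fixed one, so fixedness of the last cell
    spreads back to the whole path. *)
Lemma fixed_history i s : rsteps (rpoint Sigma VO) s -> all_valid i s ->
  fixed (bot (last (rpoint Sigma VO) (unzip2 s))) (top (last (rpoint Sigma VO) (unzip2 s))) ->
  all_ends fixed s.
Proof.
elim/last_ind: s => [|s [m r] IH]; first by constructor.
rewrite -cats1 => /rsteps_cat [st [st' _]] /List.Forall_app [vs vr].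
rewrite /unzip2 map_cat last_cat /= => h.
apply/List.Forall_app; split; last by constructor.
have v' : valid (edge i) r by inversion vr.
by apply: IH => //; apply: fixed_step (valid_last vs) v' st' h.
Qed.

(** The side changes only at a fixed cell, and then the whole history is fixed. In that case the
    image of [s1] does not depend on the side, so the old mate of [s1] can still be extended. *)
Lemma tame_extend i s2 s1 g : rsteps (rpoint Sigma VO) (s1 ++ s2) ->
  all_valid i (s1 ++ s2) -> all_ends (tame g) s1 ->
  exists2 g', all_ends (tame g') (s1 ++ s2) & g' = g \/ all_ends fixed s1.
Proof.
elim: s2 s1 g => [|[m r] s2 IH] s1 g; first by rewrite cats0; exists g => //; left.
rewrite -cat1s catA => st vs h.
have [/rsteps_cat [st1 [st2 _]] _] := (rsteps_cat _ _ _).1 st.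
have /List.Forall_app [/List.Forall_app [v1 v2] _] := vs.
have v' : valid (edge i) r by inversion v2.
have h0 : tame g (bot (last (rpoint Sigma VO) (unzip2 s1)))
    (top (last (rpoint Sigma VO) (unzip2 s1))).
  by apply: last_ends => //; case: (g).
have /orP [t|/andP [f t]] := tame_step (valid_last v1) v' st2 h0.
- have [|g' h' [eg|f]] := IH (s1 ++ [:: (m, r)]) g st vs.
  + by apply/List.Forall_app; split=> //; constructor.
  + by exists g' => //; left.
  + by exists g' => //; right; have /List.Forall_app [] := f.
- have f1 := fixed_history st1 v1 f.
  have [|g' h' _] := IH (s1 ++ [:: (m, r)]) (~~ g) st vs; last by exists g' => //; right.
  apply/List.Forall_app; split; last by constructor.
  (* Fixed cells are tame on both sides. *)
  apply: List.Forall_impl f1 => -[m' r'] /=.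
  by case: (g); case: (bot r'); case: (top r').
Qed.

Lemma rmaps_fixed g i s : all_valid i s -> all_ends fixed s -> rmaps (vmap g) s = s.
Proof.
move=> v; elim: v => [//|[m r] s' vr _ IH] f; inversion f; subst => /=.
by rewrite (fixed_vmap _ vr) // IH.
Qed.

Definition swap_same p q p' q' := [\/ swap_up p q p' q', swap_up p' q' p q,
  swap_down p q p' q' | swap_down p' q' p q].

(** Only the cell between the two exchanged steps is new, and these are both up-steps or both
    down-steps, so [tame_mid_up] or [tame_mid_down] applies to its unchanged neighbours. *)
Lemma tame_swap g i l s s' : rsteps (rpoint Sigma VO) s' -> all_valid i s' ->
  rreplaced swap_same l s s' -> all_ends (tame g) s -> all_ends (tame g) s'.
Proof.
move=> st vs [p [q [p' [q' [x [x' [y [s1 [s2 [sw _ es es']]]]]]]]]]; subst s s'.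
move=> /List.Forall_app [h1 h2]; apply/List.Forall_app; split=> //.
move/rsteps_cat: st => [st1 /= [stx [sty _]]].
move/List.Forall_app: vs => [v1 vs].
inversion vs as [|? ? vx vs']; inversion vs' as [|? ? vy _]; subst.
inversion h2 as [|? ? _ h2']; inversion h2' as [|? ? hy hs]; subst.
constructor; last by constructor.
have v0 := valid_last v1.
have h0 : tame g (bot (last (rpoint Sigma VO) (unzip2 s1)))
    (top (last (rpoint Sigma VO) (unzip2 s1))).
  by apply: last_ends => //; case: (g).
move: (last _ _) stx v0 h0 => w stx v0 h0.
have [[j [k [? ?]]]|[j [k [? ?]]]] : (exists j k, p' = D0 j /\ q' = D0 k) \/
    (exists j k, p' = D1 j /\ q' = D1 k).
- case: sw => -[j k _]; try by [left; do 2 eexists | right; do 2 eexists].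
- subst; have [lx hlx] := rlabel_ex stx; have [ly hly] := rlabel_ex sty.
  have [e1 e2 _] := up_ends vx stx hlx; have [e3 e4 _] := up_ends vy sty hly.
  by apply: tame_mid_up e2 e4 _; rewrite -?e1 // e1 e3.
- subst; have [lx hlx] := rlabel_ex stx; have [ly hly] := rlabel_ex sty.
  have [e1 e2 _] := down_ends v0 stx hlx; have [e3 e4 _] := down_ends vx sty hly.
  apply: tame_mid_down e2 e4 _ _; rewrite /= ?e1 // -e1 -e3 //.
  exact: valid_reach vy.
Qed.

(** * Matching the paths of the two HDAs *)

Local Notation H i := (graph_hda (edge i) VO).

(** One side [g] serves the whole path. Taking the second HDA at [~~ i] lets the clauses with
    exchanged roles be another instance of the same relation. *)
Definition tame_mate i (al : hpath (H i)) (be : hpath (H (~~ i))) :=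
  exists2 g, all_ends (tame g) (rpath al) & mate (vmap g) al be.

Lemma tame_mate_ex g i (al : hpath (H i)) : all_ends (tame g) (rpath al) ->
  exists be : hpath (H (~~ i)), mate (vmap g) al be.
Proof.
move=> h; apply: mate_ex; first by case: (g).
elim: h (rpath_valid al) => [|[m r] s hr _ IH] vs; first by constructor.
inversion vs; subst; constructor; last exact: IH.
exact: valid_vmap.
Qed.

Lemma similar_swap i l (al al' : hpath (H i)) : similar l al al' ->
  rreplaced swap_same l (rpath al) (rpath al').
Proof.
case=> /replaced_raw [p [q [p' [q' [x [x' [y [s1 [s2 [sw el e e']]]]]]]]]].
- by exists p, q, p', q', x, x', y, s1, s2; split=> //; apply: Or41.
- by exists p', q', p, q, x', x, y, s1, s2; split=> //; apply: Or42.
- by exists p, q, p', q', x, x', y, s1, s2; split=> //; apply: Or43.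
- by exists p', q', p, q, x', x, y, s1, s2; split=> //; apply: Or44.
Qed.

Lemma similar_sym (X : HDA Sigma) l (al al' : hpath X) : similar l al al' -> similar l al' al.
Proof. by case=> h; [apply: Or42 | apply: Or41 | apply: Or44 | apply: Or43]. Qed.

Lemma tame_mate_bisimulation i : half_bisimulation reST (@tame_mate i).
Proof.
have v0 g : vmap g VO = VO by case: g.
split; first by exists true; [constructor | ].
move=> al be [g h m]; split.
- exact: mate_ST m.
- move=> al' pre; have [s e] := prefix_rpath pre.
  have := rpath_ok al'; have := rpath_valid al'; rewrite e => v st.
  have [g' h' eg] := tame_extend st v h; rewrite -e in h'.
  have [be' m'] := tame_mate_ex h'; exists be'; last by exists g'.
  apply: (mate_prefix _ m') pre; case: eg => [-> //|f].
  (* If the side changes, [al] consists of fixed cells, and both vertex maps send it to itself. *)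
  have vs := rpath_valid al.
  by rewrite /mate m !(rmaps_fixed _ vs).
split=> // _.
- move=> l al' sim.
  have h' : all_ends (tame g) (rpath al').
    apply: (tame_swap (rpath_ok al') (rpath_valid al') (similar_swap _) h).
    exact: similar_sym sim.
  have [be' m'] := tame_mate_ex h'; exists be'; last by exists g.
  exact: mate_similar m' m sim.
- move=> al' pre; have [s e] := prefix_rpath pre.
  have h' : all_ends (tame g) (rpath al').
    by move: h; rewrite e => /List.Forall_app [].
  have [be' m'] := tame_mate_ex h'; exists be'; last by exists g.
  exact: mate_prefix m' m pre.
Qed.

(** Holds because [vmap g] is an involution that preserves tameness. The path [al'] is a copy of
    [al], since [~~ ~~ i] is convertible to [i] only when [i] is concrete. *)
Lemma tame_mate_sym i (al : hpath (H i)) (be : hpath (H (~~ i)))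
    (al' : hpath (H (~~ ~~ i))) : rpath al' = rpath al ->
  tame_mate al be -> tame_mate be al'.
Proof.
move=> e [g h m]; exists g; rewrite /mate m.
  elim: h => [|x s hx _ IH]; constructor=> //.
  by rewrite -(tame_vmap g) in hx.
rewrite e /rmaps -map_comp -[LHS]map_id; apply: eq_map => -[k r] /=.
congr pair; case: r => U f; apply: eq_existT_uncurried; exists erefl => /=.
by apply: functional_extensionality => p; rewrite vmapK.
Qed.

Lemma reST_bisimilar : bisimilar reST (H true) (H false).
Proof.
exists (@tame_mate true); split; first exact: tame_mate_bisimulation.
have -> : (fun be al => @tame_mate true al be) = @tame_mate false.
  apply: functional_extensionality => be; apply: functional_extensionality => al.
  by apply: propositional_extensionality; split=> h; apply: tame_mate_sym h.
exact: tame_mate_bisimulation.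
Qed.

End Example.

(** * Distinguishing the two HDAs by sequentialization *)

Section Distinguish.
Variables (Sigma : Type) (a b c d : Sigma).
Hypotheses (ab : a <> b) (ac : a <> c) (ad : a <> d)
  (bc : b <> c) (bd : b <> d) (cd : c <> d).

Local Notation edge := (edge a b c d).
Local Notation H i := (graph_hda (edge i) VO).
Local Notation pt := (rpoint Sigma).

Lemma edge_Ob i x : edge i VO b x -> x = VV.
Proof. by move=> h; inversion h; congruence. Qed.

Lemma edge_Va i x : edge i VV a x -> exists j, x = VW j.
Proof. by move=> h; inversion h; try congruence; eexists. Qed.

Lemma edge_bW i x j : edge i x b (VW j) -> j = i.
Proof. by move=> h; inversion h; congruence. Qed.

Lemma edge_Wc i j x : edge i (VW j) c x -> x = VZ j.
Proof. by move=> h; inversion h; congruence. Qed.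

Lemma edge_aZ i x j : edge i x a (VZ j) -> x = VU j.
Proof. by move=> h; inversion h; congruence. Qed.

Lemma edge_Ud i j x : edge i (VU j) d x -> j = true.
Proof. by move=> h; inversion h; congruence. Qed.

Let g := redge b VO VV.
Let e := redge a VV (VW true).
Let f := redge c VV (VU true).
Let q := rsquare b a VO VV VP (VW true).
Let s := rsquare a c VV (VW true) (VU true) (VZ true).

(** The paths, in order: b^+ a^+ b^- c^+ through the square Q, b^+ b^- a^+ c^+, b^+ b^- c^+ a^+, its
    prefix b^+ b^- c^+, and that prefix continued by c^- d^+. *)
Let s1 := [:: (D0 0, g); (D0 1, q); (D1 0, e); (D0 1, s)].
Let s2 := [:: (D0 0, g); (D1 0, pt VV); (D0 0, e); (D0 1, s)].
Let s3 := [:: (D0 0, g); (D1 0, pt VV); (D0 0, f); (D0 0, s)].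
Let s4 := [:: (D0 0, g); (D1 0, pt VV); (D0 0, f)].
Let s5 := s4 ++ [:: (D1 0, pt (VU true)); (D0 0, redge d (VU true) VT)].

Let vg : valid (edge true) g. Proof. by apply: valid_edge; constructor. Qed.
Let ve : valid (edge true) e. Proof. by apply: valid_edge; constructor. Qed.
Let vf : valid (edge true) f. Proof. by apply: valid_edge; constructor. Qed.
Let vq : valid (edge true) q. Proof. by apply: valid_square; constructor. Qed.
Let vs : valid (edge true) s. Proof. by apply: valid_square; constructor. Qed.

Let ex1 : exists al : hpath (H true), rpath al = s1.
Proof.
apply: path_ex; last by repeat constructor.
split; first exact: (edge_face false b VO VV).
split; first exact: (square_face1 false b a VO VV VP (VW true)).
split; first exact: (square_face0 true b a VO VV VP (VW true)).
by split; first exact: (square_face1 false a c VV (VW true) (VU true) (VZ true)).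
Qed.

Let ex2 : exists al : hpath (H true), rpath al = s2.
Proof.
apply: path_ex; last by repeat constructor => //; apply: valid_point.
split; first exact: (edge_face false b VO VV).
split; first exact: (edge_face true b VO VV).
split; first exact: (edge_face false a VV (VW true)).
by split; first exact: (square_face1 false a c VV (VW true) (VU true) (VZ true)).
Qed.

Let ex3 : exists al : hpath (H true), rpath al = s3.
Proof.
apply: path_ex; last by repeat constructor => //; apply: valid_point.
split; first exact: (edge_face false b VO VV).
split; first exact: (edge_face true b VO VV).
split; first exact: (edge_face false c VV (VU true)).
by split; first exact: (square_face0 false a c VV (VW true) (VU true) (VZ true)).
Qed.

Let ex5 : exists al : hpath (H true), rpath al = s5.
Proof.
apply: path_ex; last first.
  by repeat constructor => //; try exact: valid_point; apply: valid_edge; constructor.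
split; first exact: (edge_face false b VO VV).
split; first exact: (edge_face true b VO VV).
split; first exact: (edge_face false c VV (VU true)).
split; first exact: (edge_face true c VV (VU true)).
by split; first exact: (edge_face false d (VU true) VT).
Qed.

Let ex4 : exists al : hpath (H true), rpath al = s4.
Proof.
have [al5 e5] := ex5; apply: path_ex; have := rpath_ok al5; have := rpath_valid al5.
  by rewrite e5 => _ /rsteps_cat [].
by rewrite e5 => v _; have [] := (List.Forall_app _ s4 _).1 v.
Qed.

Lemma not_ureST_bisimilar : ~ bisimilar ureST (H true) (H false).
Proof.
move=> [R [[R0 RR] _]].
have [al1 r1] := ex1; have [al2 r2] := ex2; have [al3 r3] := ex3.
have [al4 r4] := ex4; have [al5 r5] := ex5.
have pre1 : prefix_path (path0 (H true)) al1 by exists (psteps al1).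
have [_ fw0 _] := RR _ _ R0; have [be1 _ R1] := fw0 _ pre1.
have [ST1 _ [_ sup1 _ _]] := RR _ _ R1.
(* Ending [b] before [a] starts lowers the index of [a] from 1 to 0. *)
have sub : subsumed 2 al2 al1.
  apply/replaced_raw; rewrite r1 r2.
  exists (D0 1), (D1 0), (D1 0), (D0 0), q, (pt VV), e, [:: (D0 0, g)], [:: (D0 1, s)].
  by split=> //; apply: (@SwapSub2 0 1).
have [be2 sub' R2] := sup1 isT _ _ sub.
have [ST2 _ [_ _ sim2 _]] := RR _ _ R2.
(* The starts of [a] and [c] are exchanged: [c] now comes first, on the edge [f]. *)
have sim : similar 3 al3 al2.
  apply: Or42; apply/replaced_raw; rewrite r2 r3.
  exists (D0 0), (D0 1), (D0 0), (D0 0), e, f, s, [:: (D0 0, g); (D1 0, pt VV)], [::].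
  by split=> //; apply: (@SwapUp 0 1).
have [be3 sim' R3] := sim2 isT _ _ sim.
have [ST3 _ [_ _ _ pre3]] := RR _ _ R3.
have pre43 : prefix_path al4 al3.
  by apply: (@rpath_prefix _ _ _ _ _ _ [:: (D0 0, s)]); rewrite r3 r4.
have [be4 pre43' R4] := pre3 isT _ pre43.
have [ST4 fw4 _] := RR _ _ R4.
have pre45 : prefix_path al4 al5.
  by apply: (@rpath_prefix _ _ _ _ _ _ [:: (D1 0, pt (VU true)); (D0 0, redge d (VU true) VT)]); rewrite r5 r4.
have [be5 pre45' R5] := fw4 _ pre45.
have [ST5 _ _] := RR _ _ R5.
have sz4 : 3 <= size (psteps be4).
  rewrite (same_ST_size ST4); have -> : size (psteps al4) = size (rpath al4).
    by rewrite size_map.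
  by rewrite r4.
(* Equal traces make the matching paths in [H false] take steps with the same directions and labels,
   which constrains the top corners of their cells. *)
have step1 : up_at al1 0 b.
  by apply: (@up_at_raw _ _ _ _ _ _ _ 0); rewrite r1 //; apply: edge_label.
have [b1 t1 _] := up_at_ends (same_ST_up ST1 step1).
have step2 : up_at al1 1 a.
  by apply: (@up_at_raw _ _ _ _ _ _ _ 1); rewrite r1 //; apply: square_label1.
have [b2 t2 _] := up_at_ends (same_ST_up ST1 step2).
have step3 : down_at al1 2 b.
  by apply: (@down_at_raw _ _ _ _ _ _ _ 0); rewrite r1 //; apply: square_label0.
have [t3 b3 [w tw]] := down_at_ends (same_ST_down ST1 step3).
have step4 : up_at al1 3 c.
  by apply: (@up_at_raw _ _ _ _ _ _ _ 1); rewrite r1 //; apply: square_label1.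
have [b4 t4 _] := up_at_ends (same_ST_up ST1 step4).
have step5 : up_at al3 3 a.
  by apply: (@up_at_raw _ _ _ _ _ _ _ 0); rewrite r3 //; apply: square_label0.
have [_ t5 _] := up_at_ends (same_ST_up ST3 step5).
have step6 : down_at al5 3 c.
  by apply: (@down_at_raw _ _ _ _ _ _ _ 0); rewrite r5 //; apply: edge_label.
have [t6 _ _] := down_at_ends (same_ST_down ST5 step6).
have step7 : up_at al5 4 d.
  by apply: (@up_at_raw _ _ _ _ _ _ _ 0); rewrite r5 //; apply: edge_label.
have [_ t7 _] := up_at_ends (same_ST_up ST5 step7).
(* The replacements took place at the cells 2 and 3, so cell 4 survives both; cell 3 lies in the
   common prefix [be4]. *)
have same4 : cell_at be3 4 = cell_at be1 4.
  rewrite -(similar_cell_at sim') //.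
  exact: (replaced_cell_at sub').
have same3 : cell_at be5 3 = cell_at be3 3.
  by rewrite (prefix_cell_at pre45') // (prefix_cell_at pre43').
have top1 := edge_Ob t1.
have [j top2] : exists j, top (raw (cell_at be1 2)) = VW j.
  by apply: (@edge_Va false); rewrite -top1.
(* Since [b] ends next, an edge labelled [b] enters [W_j]; in [H false] only [W_0] has one. *)
have ej : j = false by move: tw; rewrite top2 => /edge_bW.
have top4 : top (raw (cell_at be3 4)) = VZ false.
  by rewrite same4; move: t4; rewrite t3 top2 ej => /edge_Wc.
(* The start of [a] in [be3] is an edge into [Z_0], which forces the cell before it to have top
   [U_0], where no [d] can start. *)
have top3 : top (raw (cell_at be5 3)) = VU false.
  by rewrite same3; move: t5; rewrite top4 => /edge_aZ.
by move: t7; rewrite t6 top3 => /edge_Ud.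
Qed.

End Distinguish.

Theorem theorem5p14 (Sigma : Type) (a b c d : Sigma)
    (ab : a <> b) (ac : a <> c) (ad : a <> d)
    (bc : b <> c) (bd : b <> d) (cd : c <> d) :
  (forall Y Z : HDA Sigma, bisimilar ureST Y Z -> bisimilar reST Y Z) /\
  (exists Y Z : HDA Sigma, bisimilar reST Y Z /\ ~ bisimilar ureST Y Z).
Proof.
split.
  (* The clauses of a reST-bisimulation are among those of a ureST-bisimulation. *)
  have weaken (Y Z : HDA Sigma) (R : hpath Y -> hpath Z -> Prop) :
      half_bisimulation ureST R -> half_bisimulation reST R.
    move=> [R0 RR]; split=> // al be /RR [st fw [_ _ sim pre]].
    by split=> //; split.
  by move=> Y Z [R [R1 R2]]; exists R; split; apply: weaken.
exists (graph_hda (edge a b c d true) VO), (graph_hda (edge a b c d false) VO).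
split; first exact: reST_bisimilar.
exact: not_ureST_bisimilar.
Qed.
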